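(* Let $a$ and $b$ be positive integers with $a$ even and $\gcd(a,b)=1$, let $m,\ell\ge 1$ be integers, and let $c$ be a positive integer of the form $c=b+ka$ for some integer $k$, with $ma+b=c+\ell a$ (that is, $m=k+\ell$). Then the meander of type $$\frac{a|a|\cdots|a|b}{c|a|a|\cdots|a},$$ with $m$ blocks of size $a$ followed by one block of size $b$ on the top, and one block of size $c$ followed by $\ell$ blocks of size $a$ on the bottom, is Frobenius.
   Context: Let $n$ be a positive integer and let $(a_1,\ldots,a_r)$ and $(b_1,\ldots,b_s)$ be two ordered sequences of positive integers, each with sum $n$. The meander of type $\frac{a_1|a_2|\cdots|a_r}{b_1|b_2|\cdots|b_s}$ is the (multi)graph on vertices $v_1,\ldots,v_n$ placed left to right on a line, constructed as follows. Split $v_1,\ldots,v_n$ into consecutive top blocks of sizes $a_1,\ldots,a_r$, and also into consecutive bottom blocks of sizes $b_1,\ldots,b_s$. For each top block, with vertices $v_p,\ldots,v_q$, add the top edges $v_{p+i}v_{q-i}$ for all $i\ge 0$ with $p+i<q-i$. For each bottom block add bottom edges in the same way. A pair of vertices joined by both a top edge and a bottom edge forms a cycle. Every connected component is a path (possibly a single vertex) or a cycle. The index of the meander is $2C+P-1$, where $C$ is the number of cycles and $P$ the number of paths. The meander is Frobenius if its index is $0$, equivalently if the graph is a single path. *)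

(* Defs.v *)
From mathcomp Require Import all_boot all_order all_algebra.

Set Implicit Arguments.
Unset Strict Implicit.
Unset Printing Implicit Defensive.

(* A finite multigraph on [T] is given by its edge multiplicities
   [mu : T -> T -> nat]. *)
Section Multigraph.

Variables (T : finType) (mu : T -> T -> nat).

Definition adjacent : rel T := fun x y => 0 < mu x y.

Definition components : {set {set T}} :=
  equivalence_partition (connect adjacent) [set: T].

(* The multigraph induced on [A] is the path x_0 - x_1 - ... - x_(k-1) for some
   enumeration of the k = #|A| elements of [A]; k = 1 is a single vertex.  As
   the tuple has length #|A|, the equality of sets makes it duplicate-free. *)
Definition is_path (A : {set T}) : bool :=
  [exists x : #|A|.-tuple T,
     ([set y in x] == A) &&
     [forall i : 'I_#|A|, forall j : 'I_#|A|,
        mu (tnth x i) (tnth x j) == (j == i.+1 :> nat) + (i == j.+1 :> nat)]].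

(* The multigraph induced on [A] is a cycle of length k = #|A| >= 2.  For k = 2
   both summands are 1 when i != j, so this is a pair of vertices joined by a
   double edge. *)
Definition is_cycle (A : {set T}) : bool :=
  (1 < #|A|) &&
  [exists x : #|A|.-tuple T,
     ([set y in x] == A) &&
     [forall i : 'I_#|A|, forall j : 'I_#|A|,
        mu (tnth x i) (tnth x j)
          == (j == i.+1 %% #|A| :> nat) + (i == j.+1 %% #|A| :> nat)]].

Definition num_paths : nat := #|[set A in components | is_path A]|.

Definition num_cycles : nat := #|[set A in components | is_cycle A]|.

Definition graph_index : int := ((2 * num_cycles + num_paths)%:Z - 1)%R.

End Multigraph.

(* Vertices are numbered from 0, so that block [j] of the sequence [s] of block
   sizes consists of the vertices p, ..., q below.  For [i < nth 0 s j] the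
   subtraction [q - i] is not truncated. *)
Definition block_arc (s : seq nat) (u v : nat) : bool :=
  has (fun j =>
         let p := sumn (take j s) in
         let q := (p + nth 0 s j).-1 in
         has (fun i => [&& p + i < q - i, u == p + i & v == q - i])
             (iota 0 (nth 0 s j)))
      (iota 0 (size s)).

Definition block_edge (s : seq nat) (u v : nat) : bool := block_arc s u v || block_arc s v u.

(* [top] and [bot] are meant to be sequences of positive integers of sum [n].
   The two Booleans are added as naturals, so a pair of vertices joined both
   above and below has multiplicity 2. *)
Definition meander (n : nat) (top bot : seq nat) (u v : 'I_n) : nat :=
  block_edge top u v + block_edge bot u v.

Definition meander_index (n : nat) (top bot : seq nat) : int :=
  graph_index (@meander n top bot).

Definition is_frobenius (n : nat) (top bot : seq nat) : Prop :=
  meander_index n top bot = 0%R.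

(* Main.v *)
(* A function invariant under both block reversals is a word of length n that
   factors into palindromes in two ways, P_1 ... P_m Q = R S_1 ... S_l, where
   |P_i| = |S_i| = a, |Q| = b and |R| = c.  Such a word is constant when a is
   even and coprime to b, by a Euclidean descent.  If c >= 2a, deleting P_1
   replaces c by c - 2a, and symmetrically for b.  If a < b = c < 2a, trimming
   b - a letters at both ends replaces b by 2a - b.  If b < a, short windows of
   the word overlap and glue to a word of the same kind in which a is replaced
   by |a - 2b|.  The descent ends with a = 0 and b = 1.  Hence the meander is
   connected.  As c is odd, the middle of the first bottom block is fixed by the
   bottom reversal, and the alternating walk that starts there is a path through
   all the vertices. *)

Require Import Defs.
From mathcomp Require Import all_boot all_order all_algebra zify.

Set Implicit Arguments.
Unset Strict Implicit.
Unset Printing Implicit Defensive.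

Lemma coprime_sub_divisors a b a' b' :
  coprime a b -> (forall d, d %| a' -> d %| b' -> (d %| a) && (d %| b)) ->
  coprime a' b'.
Proof.
move=> /eqP co_ab dvd_ab; rewrite /coprime -dvdn1 -co_ab dvdn_gcd.
by apply: dvd_ab; rewrite ?dvdn_gcdl ?dvdn_gcdr.
Qed.

(** * Words that factor into palindromes in two ways *)

Section Words.
Variable A : Type.
Implicit Types f g : nat -> A.

(** The window is the half-open interval [p, q): the three conditions force x, y < q. Writing the
    reflection as a sum avoids truncated subtraction. *)
Definition palindrome f p q :=
  forall x y, p <= x -> p <= y -> x + y + 1 = p + q -> f x = f y.

Definition meander_word m a b c l f :=
  [/\ forall i, i < m -> palindrome f (i * a) (i.+1 * a),
      palindrome f (m * a) (m * a + b),
      palindrome f 0 c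
    & forall i, i < l -> palindrome f (c + i * a) (c + i.+1 * a)].

Definition constant_below n f := forall x y, x < n -> y < n -> f x = f y.

Lemma constant_below_from f g n n' :
  (forall x, x < n -> exists2 y, y < n' & f x = g y) ->
  constant_below n' g -> constant_below n f.
Proof.
move=> fg cg x y /fg[x' ltx' ->] /fg[y' lty' ->]; exact: cg.
Qed.

(** Reading backwards exchanges the two factorizations, so the descent may assume b <= c. *)
Lemma meander_word_rev m a b c l f (n := m * a + b) :
  n = c + l * a -> meander_word m a b c l f ->
  meander_word l a c b m (fun x => f (n - 1 - x)).
Proof.
move=> En [topa topb botc bota]; split.
- move=> i lti x y lex ley E.
  have := bota (l - i.+1) ltac:(lia); apply; nia.
- by move=> x y lex ley E; apply: botc; lia.
- by move=> x y lex ley E; apply: topb; lia.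
- move=> i lti x y lex ley E.
  have := topa (m - i.+1) ltac:(lia); apply; nia.
Qed.

(** The long bottom palindrome reflects the first top block onto its own last a letters, which
    become a new bottom block; its centre, of length c - 2a, remains. *)
Lemma meander_word_shift m a b c l f :
  2 * a <= c -> meander_word m.+1 a b c l f ->
  meander_word m a b (c - 2 * a) l.+1 (fun x => f (a + x)).
Proof.
move=> le2a [topa topb botc bota]; split.
- by move=> i lti x y lex ley E; apply: (topa i.+1); lia.
- by move=> x y lex ley E; apply: topb; lia.
- by move=> x y lex ley E; apply: botc; lia.
- case=> [|i] lti x y lex ley E; last by apply: (bota i); lia.
  transitivity (f (c - 1 - (a + x))); first by apply: botc; lia.
  transitivity (f (c - 1 - (a + y))); first by apply: (topa 0); lia.
  by apply: botc; lia.
Qed.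

(* The k bottom blocks hidden in the palindrome of length b + k * a are the
   mirror images of the first k top blocks. *)
Lemma meander_word_full m a b k l f :
  m = k + l -> meander_word m a b (b + k * a) l f ->
  forall i, i < m -> palindrome f (b + i * a) (b + i.+1 * a).
Proof.
move=> Em [topa topb botc bota] i lti x y lex ley E.
have [leki|ltik] := leqP k i.
  have [d Ei] : exists d, i = k + d by exists (i - k); lia.
  by subst i; apply: (bota d); lia.
have [d Ek] : exists d, k = i.+1 + d by exists (k - i.+1); lia.
subst k; transitivity (f (b + (i.+1 + d) * a - 1 - x)).
  by apply: botc; lia.
transitivity (f (b + (i.+1 + d) * a - 1 - y)); last by apply: botc; lia.
by apply: (topa d); lia.
Qed.

(** The blocks of size a change rows. The missing first top block is the mirror image of P_1 in R,
    the missing last bottom block that of S_m in Q; the short blocks are the centres of Q and R. *)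
Lemma meander_word_trim m a b f :
  a < b < 2 * a -> 0 < m -> meander_word m a b b m f ->
  meander_word m a (2 * a - b) (2 * a - b) m (fun x => f (b - a + x)).
Proof.
move=> /andP[ltab ltb2a] m_gt0 [topa topb botc bota]; split.
- case=> [|i] lti x y lex ley E; last by apply: (bota i); lia.
  transitivity (f (b - 1 - (b - a + x))); first by apply: botc; lia.
  transitivity (f (b - 1 - (b - a + y))); first by apply: (topa 0); lia.
  by apply: botc; lia.
- by move=> x y lex ley E; apply: topb; lia.
- by move=> x y lex ley E; apply: botc; lia.
- move=> i lti x y lex ley E.
  have [lti1|leim] := ltnP i.+1 m; first by apply: (topa i.+1); lia.
  have Em : m = i.+1 by lia.
  subst m.
  transitivity (f (2 * (i.+1 * a) + b - 1 - (b - a + x))).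
    by apply: topb; lia.
  transitivity (f (2 * (i.+1 * a) + b - 1 - (b - a + y))).
    by apply: (bota i); lia.
  by apply: topb; lia.
Qed.

Lemma window_cover k d w x :
  d <= w -> x < k * d + w -> exists i t, [/\ i <= k, t < w & x = i * d + t].
Proof.
move=> ledw; elim: k x => [|k IHk] x ltx; first by exists 0, x.
have [ltxd|ledx] := ltnP x d; first by exists 0, x; split; lia.
have [|i [t [leik ltw Ex]]] := IHk (x - d); first by lia.
by exists i.+1, t; split; lia.
Qed.

(** Agreement of consecutive windows propagates to distant ones ([hD]), so a letter does not depend
    on the window in which it is read. *)
Lemma glue_windows (h : nat -> nat -> A) m a w :
  (forall i s, i < m -> a + s < w -> h i (a + s) = h i.+1 s) ->
  exists g, forall i t, i <= m -> t < w -> g (i * a + t) = h i t.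
Proof.
move=> hS.
have hD d : forall i s, i + d <= m -> d * a + s < w ->
    h i (d * a + s) = h (i + d) s.
  elim: d => [|d IHd] i s leim ltw; first by rewrite addn0.
  rewrite mulSn -addnA hS; try lia.
  by rewrite IHd; [congr h; lia | lia | lia].
(* The letter is read in the last window that starts at or before x. For a = 0 all windows start at
   0, and division by zero selects window 0. *)
exists (fun x => h (minn (x %/ a) m) (x - minn (x %/ a) m * a)) => i t leim ltw.
case: (posnP a) => [a0|a_gt0].
  rewrite a0 divn0 min0n subn0 muln0 add0n.
  by have := hD i 0 t; rewrite a0 muln0 !add0n; apply.
set j := minn _ m.
have leij : i <= j by rewrite leq_min leim andbT divnMDl // leq_addr.
have lejt : j * a <= i * a + t.
  by apply: leq_trans (leq_divM _ a); rewrite leq_mul2r geq_minl orbT.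
have Ej : j * a = i * a + (j - i) * a by rewrite -mulnDl subnKC.
have lejm : j <= m by exact: geq_minr.
have -> : t = (j - i) * a + (i * a + t - j * a) by lia.
by rewrite hD; [congr h; lia | lia | lia].
Qed.

(** Reflecting in top block i, then in the palindrome at b + i * a, translates by 2b. So letters a -
    2b, ..., a - b - 1 of block i are the first b letters of block i + 1, and the windows formed by
    the first a - b letters of the blocks can be glued at distance a - 2b. *)
Lemma meander_word_euclid_wide m a b k l f :
  0 < b -> 2 * b <= a -> m = k + l -> meander_word m a b (b + k * a) l f ->
  exists2 g, meander_word m (a - 2 * b) b (b + k * (a - 2 * b)) l g
    & forall x, x < m * a + b ->
      exists2 y, y < m * (a - 2 * b) + b & f x = g y.
Proof.
move=> b_gt0 le2ba Em fW; have bot := meander_word_full Em fW.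
case: fW => topa topb botc _.
have [d Ea] : exists d, a = d + 2 * b by exists (a - 2 * b); lia.
rewrite {le2ba}Ea addnK in topa topb botc bot *.
(* Window m may run past the end of f, but its letters after the first b also lie past the length m
   * d + b of the new word. *)
have [|g gE] := @glue_windows (fun i t => f (i * (d + 2 * b) + t)) m d (d + b).
  move=> i s lti lts.
  transitivity (f (i * (d + 2 * b) + (2 * b - 1 - s))).
    by apply: (topa i); lia.
  by apply: (bot i); lia.
have gE' x i t : x = i * d + t -> i <= m -> t < d + b ->
  g x = f (i * (d + 2 * b) + t) by move=> ->; apply: gE.
exists g.
  split.
  - move=> i lti x y lex ley E.
    rewrite (gE' x i (x - i * d)) ?(gE' y i (y - i * d)); try lia.
    set t := x - i * d.
    (* The new reversal is the bottom reversal conjugated by the top one. *)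
    transitivity (f (i * (d + 2 * b) + (d + 2 * b - 1 - t))).
      by apply: (topa i); lia.
    transitivity (f (i * (d + 2 * b) + (2 * b + t))).
      by apply: (bot i); lia.
    by apply: (topa i); lia.
  - move=> x y lex ley E.
    rewrite (gE' x m (x - m * d)) ?(gE' y m (y - m * d)); try lia.
    by apply: topb; lia.
  - have [k0|k_gt0] := posnP k.
      move=> x y _ _ E; rewrite (gE' x 0 x) ?(gE' y 0 y); try lia.
      by apply: botc; lia.
    move=> x y _ _ E.
    (* Windows 0, ..., k - 1 cover the new long bottom palindrome, whose reversal exchanges windows
       i and k - 1 - i. *)
    have [||i [t [leik ltt Ex]]] := @window_cover k.-1 d (d + b) x; try nia.
    have [j Ek] : exists j, k = (i + j).+1 by exists (k.-1 - i); lia.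
    subst k; rewrite (gE' x i t) ?(gE' y j (d + b - 1 - t)); try lia.
    transitivity (f (j * (d + 2 * b) + (d + 2 * b + b - 1 - t))).
      by apply: botc; lia.
    transitivity (f (j * (d + 2 * b) + (b + t))).
      by apply: (bot j); lia.
    by apply: (topa j); lia.
  - move=> i lti x y lex ley E.
    rewrite (gE' x (k + i) (x - (k + i) * d))
      ?(gE' y (k + i) (y - (k + i) * d)); try lia.
    by apply: (topa (k + i)); lia.
- move=> x ltx.
  have [lemx|ltxm] := leqP (m * (d + 2 * b)) x.
    exists (m * d + (x - m * (d + 2 * b))); first by lia.
    by rewrite gE; [congr f; lia | lia | lia].
  have m_gt0 : 0 < m by case: (m) ltxm.
  have [||i [t [leim ltt Ex]]] :=
    @window_cover m.-1 (d + 2 * b) (d + 2 * b) x; try nia.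
  have [ltt'|let'] := ltnP t (d + b).
    by exists (i * d + t); [nia | rewrite gE ?Ex //; lia].
  exists (i * d + (d + 2 * b - 1 - t)); first by nia.
  by rewrite gE; [apply: (topa i); lia | lia | lia].
Qed.

(** The translation by 2b now passes a whole block by d = 2b - a. The windows are the first b
    letters of the blocks, each read backwards so that they overlap in increasing order, in v = a -
    b letters. *)
Lemma meander_word_euclid_narrow m a b k l f :
  b <= a <= 2 * b -> m = k + l -> meander_word m a b (b + k * a) l f ->
  exists2 g, meander_word m (2 * b - a) b (b + k * (2 * b - a)) l g
    & forall x, x < m * a + b ->
      exists2 y, y < m * (2 * b - a) + b & f x = g y.
Proof.
move=> /andP[leba lea2b] Em fW; have bot := meander_word_full Em fW.
case: fW => topa topb botc _.
have [d [v [Ea Eb]]] : exists d v, a = d + 2 * v /\ b = d + v.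
  by exists (2 * b - a), (a - b); lia.
have -> : 2 * b - a = d by lia.
subst a b.
have [|g gE] := @glue_windows
    (fun i t => f (i * (d + 2 * v) + (d + v - 1 - t))) m d (d + v).
  move=> i s lti lts.
  transitivity (f (i * (d + 2 * v) + (d + v + s))).
    by apply: (topa i); lia.
  by apply: (bot i); lia.
have gE' x i t : x = i * d + t -> i <= m -> t < d + v ->
  g x = f (i * (d + 2 * v) + (d + v - 1 - t)) by move=> ->; apply: gE.
exists g.
  split.
  - move=> i lti x y lex ley E.
    rewrite (gE' x i (x - i * d)) ?(gE' y i (y - i * d)); try lia.
    by apply: (topa i); lia.
  - move=> x y lex ley E.
    rewrite (gE' x m (x - m * d)) ?(gE' y m (y - m * d)); try lia.
    by apply: topb; lia.
  - move=> x y _ _ E.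
    have [||i [t [leik ltt Ex]]] := @window_cover k d (d + v) x; try lia.
    have [j Ek] : exists j, k = i + j by exists (k - i); lia.
    subst k; rewrite (gE' x i t) ?(gE' y j (d + v - 1 - t)); try lia.
    by apply: botc; lia.
  - move=> i lti x y lex ley E.
    (* The first d letters of block k + i + 1 are the centre of the palindrome at b + (k + i) *
       a. *)
    rewrite (gE' x (k + i).+1 (x - (k + i).+1 * d)).
    rewrite ?(gE' y (k + i).+1 (y - (k + i).+1 * d)); try lia.
    all: try lia.
    by apply: (bot (k + i)); lia.
- move=> x ltx.
  have [lemx|ltxm] := leqP (m * (d + 2 * v)) x.
    exists (m * d + (d + v - 1 - (x - m * (d + 2 * v)))); first by lia.
    by rewrite gE; [congr f; lia | lia | lia].
  have m_gt0 : 0 < m by case: (m) ltxm.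
  have [||i [t [leim ltt Ex]]] :=
    @window_cover m.-1 (d + 2 * v) (d + 2 * v) x; try nia.
  have [ltt'|let'] := ltnP t (d + v).
    exists (i * d + (d + v - 1 - t)); first by nia.
    by rewrite gE; [congr f; lia | lia | lia].
  exists (i * d + (t - v)); first by nia.
  by rewrite gE; [apply: (topa i); lia | lia | lia].
Qed.

Lemma meander_word_constant m a b c l f :
  ~~ odd a -> coprime a b -> 0 < m + l -> m * a + b = c + l * a ->
  meander_word m a b c l f -> constant_below (m * a + b) f.
Proof.
have [N] := ubnP (a + b + c); elim: N => // N IHN in m a b c l f *.
wlog lebc : m b c l f / b <= c => [hwlog|].
  have [lebc|ltcb] := leqP b c; first exact: hwlog.
  move=> ltN a_even co_ab ml_gt0 En fW.
  apply: (@constant_below_from f (fun x => f (m * a + b - 1 - x))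
            _ (l * a + c)).
    move=> x ltx; exists (m * a + b - 1 - x); first by lia.
    by congr f; lia.
  apply: (hwlog l c b m) => //; try lia.
    by move: co_ab; rewrite /coprime -(gcdnMDl m) En addnC gcdnMDl.
  exact: meander_word_rev.
move=> ltN a_even co_ab ml_gt0 En fW.
have [a0|a_gt0] := posnP a.
  move: co_ab; rewrite a0 /coprime gcd0n => /eqP b1 x y ltx lty.
  by congr f; lia.
have m_gt0 : 0 < m by case: (m) fW En ml_gt0 => // _ ; nia.
have [le2ac|ltc2a] := leqP (2 * a) c.
  case: m m_gt0 ml_gt0 fW En => // m _ ml_gt0 fW En.
  apply: (@constant_below_from f (fun x => f (a + x)) _ (m * a + b)).
    move=> x ltx; have [ltxa|leax] := ltnP x a.
      exists (c - 1 - x - a); first by lia.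
      by case: fW => _ _ botc _; apply: botc; lia.
    by exists (x - a); [lia | congr f; lia].
  apply: (IHN m a b (c - 2 * a) l.+1) => //; try lia.
  exact: meander_word_shift.
(* Now b <= c < 2a, so k is 0 or 1. *)
have [k Em] : exists k, m = k + l by exists (m - l); nia.
have Ec : c = b + k * a by nia.
have b_odd : odd b.
  apply: contraTT co_ab => b_even; apply/eqP => gcd1.
  by have := dvdn_gcd 2 a b; rewrite gcd1 !dvdn2 a_even b_even.
(* Parity rules out a = b = 1, where the descent would be stuck with one-letter blocks that impose
   nothing. *)
have neq_ab : a != b by apply: contraNneq a_even => ->.
subst c.
have [ltab|leba] := ltnP a b.
  have k0 : k = 0 by nia.
  subst k; rewrite mul0n addn0 add0n in fW Em ltc2a *; subst l.
  apply: (@constant_below_from f (fun x => f (b - a + x))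
            _ (m * a + (2 * a - b))).
    have [_ topb botc _] := fW.
    move=> x ltx; have [ltxd|ledx] := ltnP x (b - a).
      exists (b - 1 - x - (b - a)); first by nia.
      by apply: botc; lia.
    have [ltxn|lenx] := ltnP (x - (b - a)) (m * a + (2 * a - b)).
      by exists (x - (b - a)); [|congr f; lia].
    exists (2 * (m * a) + b - 1 - x - (b - a)); first by nia.
    by apply: topb; nia.
  apply: (IHN m a (2 * a - b) (2 * a - b) m) => //; try lia.
    apply: coprime_sub_divisors co_ab _ => d da db; rewrite da /=.
    by rewrite -(@dvdn_subr d (2 * a)) ?dvdn_mull // ltnW.
  by apply: meander_word_trim; rewrite ?ltab.
have ltba : b < a by lia.
have b_gt0 : 0 < b by case: (b) b_odd.
have [le2ba|lta2b] := leqP (2 * b) a.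
  have [g gW fg] := meander_word_euclid_wide b_gt0 le2ba Em fW.
  apply: constant_below_from fg _.
  apply: (IHN m (a - 2 * b) b (b + k * (a - 2 * b)) l) => //; try nia.
  apply: coprime_sub_divisors co_ab _ => d da db; rewrite db andbT.
  by rewrite -(@dvdn_subl d a (2 * b) le2ba) ?dvdn_mull.
have [|g gW fg] := meander_word_euclid_narrow _ Em fW; first by lia.
apply: constant_below_from fg _.
apply: (IHN m (2 * b - a) b (b + k * (2 * b - a)) l) => //; try nia.
apply: coprime_sub_divisors co_ab _ => d da db; rewrite db andbT.
by rewrite -(@dvdn_subr d (2 * b)) ?dvdn_mull // ltnW.
Qed.

End Words.

(** * The alternating walk of two involutions *)

Section Walk.
Variables (V : finType) (T B : V -> V) (v0 : V).
Hypotheses (TK : involutive T) (BK : involutive B) (Bv0 : B v0 = v0).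

(** [turn i] leads out of [walk i] and [turn i.+1] leads back; at i = 0 the latter is B, which fixes
    v0. *)
Definition turn i := if odd i then B else T.

Fixpoint walk i := if i is j.+1 then turn j (walk j) else v0.

Lemma turnK i : involutive (turn i).
Proof. by rewrite /turn; case: ifP. Qed.

Lemma eq_odd_turn i j : odd i = odd j -> turn i = turn j.
Proof. by rewrite /turn => ->. Qed.

(* If the step out of i and the step into j use the same involution, then
   walk i.+1 = walk j.-1, and so on until the two indices are adjacent.
   Otherwise both indices go down by one until i = 0, where B v0 = v0 replaces
   j by j.-1 and thus leads to the first case. *)
Lemma walk_collision i j :
  i < j -> walk i = walk j -> exists2 h, h < j & walk h.+1 = walk h.
Proof.
elim/ltn_ind: j i => -[//|j] IHj i; rewrite ltnS => leij Eij.
have [Epar|Npar] := eqVneq (odd i) (odd j).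
  have [eij|neij] := eqVneq i j; first by exists j; rewrite // -Eij eij.
  have ltij : i.+1 < j by case: (ltngtP i.+1 j) neij => [||] //; lia.
  have [||h lthj Eh] := IHj j _ i.+1 ltij; rewrite //=.
    by rewrite Eij /= (eq_odd_turn Epar) turnK.
  by exists h; rewrite // ltnS ltnW.
case: i => [|i] in leij Eij Npar *.
  have j_odd : odd j by case: (odd j) Npar.
  have Ej : walk 0 = walk j.
    by rewrite /= -{1}Bv0 [v0]Eij /= /turn j_odd BK.
  have [||h lthj Eh] := IHj j _ 0 _ Ej; rewrite ?odd_gt0 //.
  by exists h; rewrite // ltnS ltnW.
have Epar : odd i = odd j by move: Npar => /=; case: (odd i) (odd j) => [] [].
have [|h lthj Eh] := IHj j (ltnSn j) i leij.
  by apply: (can_inj (turnK j)); rewrite -[RHS]Eij /= (eq_odd_turn Epar).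
by exists h; rewrite // ltnS ltnW.
Qed.

(** By pigeonhole the walk repeats a vertex, hence has a stationary step. Before the first one no
    vertex repeats, since a repetition would yield an earlier one. *)
Lemma walk_stops : exists2 N, walk N.+1 = walk N
  & forall i j, i <= N -> j <= N -> walk i = walk j -> i = j.
Proof.
have exN : exists N, walk N.+1 == walk N.
  have /injectivePn[i [j neij Eij]] :
      ~~ injectiveb (fun i : 'I_#|V|.+1 => walk i).
    by apply/injectiveP => /leq_card; rewrite card_ord ltnn.
  have [ltij|ltji|/val_inj eij] := ltngtP i j; last by rewrite eij eqxx in neij.
    by have [h _ Eh] := walk_collision ltij Eij; exists h; apply/eqP.
  by have [h _ Eh] := walk_collision ltji (esym Eij); exists h; apply/eqP.
case: (ex_minnP exN) => N /eqP EN minN; exists N => //.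
have no_collision i j : i < j -> j <= N -> walk i <> walk j.
  move=> ltij lejN /(walk_collision ltij)[h lthj /eqP/minN leNh].
  by move: (leq_trans lthj lejN); rewrite ltnNge leNh.
move=> i j leiN lejN Eij; case: (ltngtP i j) => // lt.
  by case: (no_collision _ _ lt lejN).
by case: (no_collision _ _ lt leiN).
Qed.

Variable mu : V -> V -> nat.
(** The factor [u != v] is there because a fixed point, the middle of an odd block, carries no
    arc. *)
Hypothesis muE :
  forall u v, mu u v = (u != v) * ((T u == v) + (B u == v)).
Hypothesis connTB : forall S : {set V},
  v0 \in S -> (forall v, v \in S -> T v \in S) ->
  (forall v, v \in S -> B v \in S) -> S = setT.

Lemma mu_turn i u v :
  mu u v = (u != v) * ((turn i u == v) + (turn i.+1 u == v)).
Proof. by rewrite muE /turn /=; case: (odd i) => //=; rewrite [in RHS]addnC. Qed.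

Lemma components_setT : components mu = [set setT].
Proof.
have step s : s = T \/ s = B -> forall u, connect (adjacent mu) u (s u).
  move=> sTB u; have [<-|neq] := eqVneq u (s u); first exact: connect0.
  apply: connect1; rewrite /adjacent muE neq mul1n addn_gt0 !lt0b.
  by case: sTB => <-; rewrite eqxx ?orbT.
have conn0 v : connect (adjacent mu) v0 v.
  have /setP/(_ v) : [set v | connect (adjacent mu) v0 v] = setT.
    apply: connTB => [|u|u]; rewrite !inE ?connect0 // => cu.
      by apply: connect_trans cu (step _ _ u); left.
    by apply: connect_trans cu (step _ _ u); right.
  by rewrite !inE.
have symc : connect_sym (adjacent mu).
  apply: sym_connect_sym => u v; rewrite /adjacent !muE eq_sym.
  by rewrite (can2_eq TK TK) (can2_eq BK BK) ![_ == u]eq_sym.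
apply/setP => S; rewrite inE; apply/imsetP/eqP => [[u _ ->]|->].
  apply/setP => v; rewrite !inE /=; apply: connect_trans (conn0 v).
  by rewrite symc.
exists v0; rewrite ?inE //; apply/setP => v.
by rewrite !inE conn0.
Qed.

(** The walk up to its first stationary step is closed under T and B, as each end is fixed by the
    involution that would leave it. By [connTB] it visits every vertex. *)
Lemma is_path_setT : is_path mu setT.
Proof.
have [N EN injN] := walk_stops.
have nextE i j : i <= N -> j <= N -> walk i != walk j ->
    (turn i (walk i) == walk j) = (j == i.+1).
  rewrite leq_eqVlt => /predU1P[->|ltiN] lejN neq.
    rewrite -[turn N _]/(walk N.+1) EN (negPf neq).
    by apply/esym/negbTE; rewrite neq_ltn ltnS lejN.
  apply/eqP/eqP => [/(injN i.+1 j ltiN lejN)|->] //.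
have prevE i j : i <= N -> j <= N -> walk i != walk j ->
    (turn i.+1 (walk i) == walk j) = (i == j.+1).
  case: i => [|i] leiN lejN neq; first by rewrite /turn /= Bv0 (negPf neq).
  rewrite (@eq_odd_turn i.+2 i) /= ?negbK // turnK eqSS.
  by apply/eqP/eqP => [/(injN i j (ltnW leiN) lejN)|->].
have walkT : [set walk i | i : 'I_N.+1] = setT.
  have closed s : s = T \/ s = B -> forall v,
    v \in [set walk i | i : 'I_N.+1] -> s v \in [set walk i | i : 'I_N.+1].
    move=> sTB _ /imsetP[[i ltiN] _ /= ->].
    have [->|->] : s = turn i \/ s = turn i.+1.
    - by rewrite /turn /=; case: (odd i); case: sTB => ->;
        [right | left | left | right].
    - have [lt|le] := ltnP i N.
        by apply/imsetP; exists (Ordinal (lt : i.+1 < N.+1)).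
      have -> : i = N by apply/eqP; rewrite eqn_leq le -ltnS ltiN.
      by rewrite -[turn N _]/(walk N.+1) EN; apply/imsetP; exists ord_max.
    - case: i ltiN => [|i] ltiN.
        by rewrite /turn /= Bv0; apply/imsetP; exists ord0.
      rewrite (@eq_odd_turn i.+2 i) /= ?negbK // turnK.
      by apply/imsetP; exists (Ordinal (ltnW ltiN)).
  apply: connTB => [|v|v]; [|by apply: closed; left|by apply: closed; right].
  by apply/imsetP; exists ord0.
have cardV : #|[set: V]| = N.+1.
  rewrite -walkT card_imset ?card_ord // => i j Eij.
  by apply/val_inj/injN => //; rewrite -ltnS ltn_ord.
apply/existsP; exists [tuple walk i | i < #|[set: V]|]; apply/andP; split.
  apply/eqP/setP => v; rewrite !inE; apply/mapP.
  have /imsetP[i _ ->] : v \in [set walk i | i : 'I_N.+1] by rewrite walkT inE.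
  have ltin : i < #|[set: V]| by rewrite cardV.
  by exists (Ordinal ltin); rewrite ?mem_enum.
apply/forallP => i; apply/forallP => j; rewrite !tnth_mktuple (mu_turn i).
have leiN : i <= N by rewrite -ltnS -cardV.
have lejN : j <= N by rewrite -ltnS -cardV.
have [Eij|neq] := eqVneq (walk i) (walk j).
  by rewrite (injN i j leiN lejN Eij) mul0n (ltn_eqF (ltnSn j)).
by rewrite mul1n nextE ?prevE.
Qed.

(** As B fixes v0, its only possible neighbour is T v0, by a simple edge. On a cycle both neighbours
    of v0 would be T v0, which forces a double edge. *)
Lemma setT_not_cycle : ~~ is_cycle mu setT.
Proof.
apply/negP => /andP[n_gt1 /existsP[x /andP[/eqP xT /forallP xE]]].
set n := #|[set: V]| in n_gt1 x xT xE.
have injx : injective (tnth x).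
  apply/tuple_uniqP; apply/card_uniqP.
  by rewrite size_tuple -cardsE xT.
have /tnthP[i v0E] : v0 \in x.
  by have /setP/(_ v0) := xT; rewrite !inE.
have n_gt0 : 0 < n by exact: ltnW.
pose j1 := Ordinal (ltn_pmod i.+1 n_gt0).
pose j2 := Ordinal (ltn_pmod (i + n.-1) n_gt0).
have mu_v0 v : mu v0 v = (v0 != v) * (T v0 == v).
  by rewrite muE Bv0; case: eqVneq; rewrite ?mul0n ?addn0.
have mu_i j : mu (tnth x i) (tnth x j) =
    (j == i.+1 %% n :> nat) + (i == j.+1 %% n :> nat).
  by apply/eqP; have /forallP := xE i; apply.
have Ej1 : T v0 = tnth x j1.
  apply/eqP; have := mu_i j1; rewrite -v0E mu_v0 eqxx /=.
  by case: (T v0 == _) => //; rewrite muln0.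
have j2i : (i == j2.+1 %% n :> nat).
  by rewrite /= -addn1 modnDml -addnA addn1 prednK // modnDr modn_small.
have Ej2 : T v0 = tnth x j2.
  apply/eqP; have := mu_i j2; rewrite -v0E mu_v0 j2i addn1.
  by case: (T v0 == _) => //; rewrite muln0.
have Ej : j1 = j2 by apply: injx; rewrite -Ej1.
have := mu_i j1; rewrite {3}Ej j2i eqxx -v0E mu_v0.
by case: (_ != _); case: (_ == _).
Qed.

Lemma graph_index_eq0 : graph_index mu = 0%R.
Proof.
rewrite /graph_index /num_cycles /num_paths components_setT.
have -> : [set S in [set setT] | is_cycle mu S] = set0.
  apply/setP => S; rewrite !inE; case: eqVneq => //= ->.
  exact: negPf setT_not_cycle.
have -> : [set S in [set setT] | is_path mu S] = [set setT].
  apply/setP => S; rewrite !inE; case: eqVneq => //= ->.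
  exact: is_path_setT.
by rewrite cards0 cards1.
Qed.

End Walk.

(** * Block reversals and their arcs *)

Fixpoint mirror s u :=
  if s is k :: s' then if u < k then k - 1 - u else k + mirror s' (u - k) else u.

Definition block_start s j := sumn (take j s).

Lemma block_start_nth s j :
  j < size s -> block_start s j.+1 = block_start s j + nth 0 s j.
Proof. by move=> ltj; rewrite /block_start (take_nth 0 ltj) sumn_rcons. Qed.

Lemma mirror_eq s j u v :
  j < size s -> block_start s j <= u -> block_start s j <= v ->
  u + v + 1 = block_start s j + block_start s j.+1 -> mirror s u = v.
Proof.
rewrite /block_start; elim: s j u v => [|k s IHs] [|j] u v //= ltj lu lv E.
  by rewrite take0 /= in E; case: ltnP; lia.
by case: ltnP => [|leku]; [lia | rewrite (IHs j (u - k) (v - k)); lia].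
Qed.

Lemma mirror_block s u : u < sumn s ->
  exists j, [/\ j < size s, block_start s j <= u, block_start s j <= mirror s u
    & u + mirror s u + 1 = block_start s j + block_start s j.+1].
Proof.
rewrite /block_start; elim: s u => [|k s IHs] u //= ltu; case: ltnP => [ltuk|leku].
  by exists 0; split; rewrite //= take0 /=; lia.
have [|j [ltj lu lm E]] := IHs (u - k); first by lia.
by exists j.+1; split => //=; lia.
Qed.

Lemma block_start_le s j : block_start s j <= sumn s.
Proof. by rewrite -{2}(cat_take_drop j s) sumn_cat leq_addr. Qed.

Lemma mirror_lt s u : u < sumn s -> mirror s u < sumn s.
Proof.
move=> /mirror_block[j [_ lu _ E]].
by have := block_start_le s j.+1; lia.
Qed.

Lemma mirrorK s u : u < sumn s -> mirror s (mirror s u) = u.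
Proof.
by move=> /mirror_block[j [ltj lu lm E]]; apply: (mirror_eq ltj lm lu); lia.
Qed.

Lemma block_arcE s u v : u < sumn s ->
  block_arc s u v = (u < v) && (mirror s u == v).
Proof.
move=> ltu; apply/hasP/andP => [[j]|[ltuv /eqP Ev]].
  rewrite mem_iota add0n => /= ltj /hasP[i].
  rewrite mem_iota add0n => /= lti /and3P[lt /eqP Eu /eqP Ev].
  have Ej := block_start_nth ltj; rewrite -/(block_start s j) in lt Eu Ev.
  by split; [lia | apply/eqP/(mirror_eq ltj); lia].
have [j [ltj lu lm E]] := mirror_block ltu.
have Ej := block_start_nth ltj.
exists j; first by rewrite mem_iota.
rewrite /= -/(block_start s j); apply/hasP; exists (u - block_start s j).
  by rewrite mem_iota; lia.
by apply/and3P; split; lia.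
Qed.

(** Arcs run from left end to right end; the two orientations u < v and v < u together give
    [u != v]. *)
Lemma block_edgeE s u v : u < sumn s -> v < sumn s ->
  block_edge s u v = (u != v) && (mirror s u == v).
Proof.
move=> ltu ltv; rewrite /block_edge !block_arcE //.
have -> : (mirror s v == u) = (mirror s u == v).
  by apply/eqP/eqP => <-; rewrite mirrorK.
by rewrite -andb_orl neq_ltn.
Qed.

Lemma invariant_palindrome (A : Type) s (f : nat -> A) j :
  (forall u, u < sumn s -> f (mirror s u) = f u) -> j < size s ->
  palindrome f (block_start s j) (block_start s j.+1).
Proof.
move=> fM ltj x y lex ley E; rewrite -(mirror_eq ltj lex ley E) fM //.
by have := block_start_le s j.+1; lia.
Qed.

(** * From constant words to the meander *)

Theorem corollary18 (a b m l c : nat) (k : int)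
    (a_gt0 : 0 < a) (b_gt0 : 0 < b) (a_even : ~~ odd a) (gcd_ab : gcdn a b = 1)
    (m_ge1 : 1 <= m) (l_ge1 : 1 <= l) (c_gt0 : 0 < c)
    (c_def : (c%:Z = b%:Z + k * a%:Z)%R)
    (sum_eq : m * a + b = c + l * a) :
  is_frobenius (m * a + b) (rcons (nseq m a) b) (c :: nseq l a).
Proof.
set top := rcons _ _; set bot := c :: _; set n := m * a + b.
have sum_top : sumn top = n by rewrite sumn_rcons sumn_nseq mulnC.
have sum_bot : sumn bot = n by rewrite /= sumn_nseq mulnC -sum_eq.
have start_top j : j <= m -> block_start top j = j * a.
  move=> lejm; rewrite /block_start /top -cats1 takel_cat ?size_nseq //.
  by rewrite take_nseq // sumn_nseq mulnC.
have start_top_end : block_start top m.+1 = n.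
  by rewrite /block_start take_oversize // size_rcons size_nseq.
have start_bot j : j <= l -> block_start bot j.+1 = c + j * a.
  by move=> lejl; rewrite /block_start /= take_nseq // sumn_nseq mulnC.
have ltT (u : 'I_n) : mirror top u < n.
  by rewrite -[X in _ < X]sum_top mirror_lt // sum_top.
have ltB (u : 'I_n) : mirror bot u < n.
  by rewrite -[X in _ < X]sum_bot mirror_lt // sum_bot.
have c_odd : odd c.
  have b_odd : odd b.
    apply: contraT => b_even.
    by have := dvdn_gcd 2 a b; rewrite gcd_ab !dvdn2 a_even b_even.
  by have := congr1 odd sum_eq; rewrite !oddD !oddM (negPf a_even) b_odd; lia.
(* The walk starts at the middle of the first bottom block: c - 1 - c./2 = c./2 for odd c. *)
have lt_mid : c./2 < n by lia.
apply: (@graph_index_eq0 _ (fun u => Ordinal (ltT u)) (fun u => Ordinal (ltB u))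
          (Ordinal lt_mid)).
- by move=> u; apply/val_inj/mirrorK; rewrite sum_top.
- by move=> u; apply/val_inj/mirrorK; rewrite sum_bot.
- apply/val_inj; rewrite /= ifT; lia.
- move=> u v; rewrite /meander !block_edgeE ?sum_top ?sum_bot //.
  by rewrite -!val_eqE /=; case: (_ != _); rewrite ?mul0n ?mul1n.
(* The word is the indicator of S, extended by false beyond n. Once it is constant, S is everything
   because it contains the starting vertex. *)
move=> S S0 ST SB; pose f x := [exists u : 'I_n, (u == x :> nat) && (u \in S)].
have fE (u : 'I_n) : f u = (u \in S).
  apply/existsP/idP => [[v /andP[/eqP/val_inj-> //]]|uS].
  by exists u; rewrite eqxx.
have inv (M : nat -> nat) (ltM : forall u : 'I_n, M u < n) :
    (forall u, u < n -> M (M u) = u) ->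
    (forall v, v \in S -> Ordinal (ltM v) \in S) ->
    forall u, u < n -> f (M u) = f u.
  move=> MK SM u ltu; rewrite -[M u]/(val (Ordinal (ltM (Ordinal ltu)))).
  rewrite -[u in RHS]/(val (Ordinal ltu)) !fE.
  apply/idP/idP => [/SM|/SM //]; congr (_ \in S).
  by apply/val_inj; rewrite /= MK.
have fT := inv (mirror top) ltT; have fB := inv (mirror bot) ltB.
have fW : meander_word m a b c l f.
  have palT j : j <= m -> palindrome f (block_start top j) (block_start top j.+1).
    move=> lejm; apply: invariant_palindrome.
      by rewrite sum_top; apply: fT => // u ltu; apply: mirrorK; rewrite sum_top.
    by rewrite size_rcons size_nseq.
  have palB j : j <= l -> palindrome f (block_start bot j) (block_start bot j.+1).
    move=> lejl; apply: invariant_palindrome.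
      by rewrite sum_bot; apply: fB => // u ltu; apply: mirrorK; rewrite sum_bot.
    by rewrite /= size_nseq.
  split.
  - by move=> i lti; have := palT i (ltnW lti); rewrite !start_top // ltnW.
  - by have := palT m (leqnn m); rewrite start_top_end start_top.
  - by have := palB 0 (leq0n l); rewrite start_bot // mul0n addn0.
  - by move=> i lti; have := palB i.+1 lti; rewrite !start_bot // ltnW.
have cf : constant_below n f.
  by apply: meander_word_constant fW; rewrite // ?addn_gt0 ?m_ge1 // /coprime gcd_ab.
by apply/setP => u; rewrite inE -fE (cf u (Ordinal lt_mid)) // fE.
Qed.
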